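(* (Divergence Principle) Let $S\subset\mathbb{R}^n$ be a surface with band $B(S)$ (as in the context), and let $\operatorname{cp}:B(S)\to S$ be a closest point function. Then for every continuously differentiable surface vector field $g:S\to\mathbb{R}^n$ (not necessarily tangential to $S$), $$\operatorname{div}[g\circ\operatorname{cp}](y)=\operatorname{div}_Sg(y)\qquad\text{for all } y\in S,$$ where $\operatorname{div}$ is the ordinary divergence in $\mathbb{R}^n$ and $\operatorname{div}_S$ the surface divergence.
   Context: Surfaces. $S$ is an embedded $C^2$-submanifold of $\mathbb{R}^n$ without boundary (if there is a boundary, $S$ is identified with its interior), of dimension $k\le n$, possessing a tubular neighborhood $B(S)\subset\mathbb{R}^n$, an open set containing $S$, called a band around $S$. $S$ is orientable in the sense that, if $k<n$, there are smooth unit vector fields $N_1,\dots,N_{n-k}:S\to\mathbb{R}^n$ spanning the normal space $\mathcal{N}_yS$ at each $y\in S$. $\mathcal{T}_yS$ is the tangent space, and $P(y)\in\mathbb{R}^{n\times n}$ is the orthogonal projector of $\mathbb{R}^n$ onto $\mathcal{T}_yS$. Surface divergence. For a $C^1$ vector field $g:S\to\mathbb{R}^n$ and $y\in S$, let $g_E:\Omega_E\to\mathbb{R}^n$ be any $C^1$ extension of $g$ near $y$: $\Omega_E\subset\mathbb{R}^n$ is open, contains $y$, and $g_E=g$ on $S\cap\Omega_E$. Then $\operatorname{div}_Sg(y):=\operatorname{trace}(Dg_E(y)\cdot P(y))$ (independent of the chosen extension). Closest point function. A map $\operatorname{cp}:B(S)\to S$ is a closest point function if (1) it is a $C^1$-retraction,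 i.e. $\operatorname{cp}$ is continuously differentiable (as a map into $\mathbb{R}^n$) and $\operatorname{cp}(y)=y$ for all $y\in S$; and (2) its Jacobian satisfies $D\operatorname{cp}(y)=P(y)$ for all $y\in S$. *)

(* Defs.v *)
From HB Require Import structures.
From mathcomp Require Import all_boot all_order all_algebra.
From mathcomp Require Import all_classical all_reals all_analysis.

Set Implicit Arguments.
Unset Strict Implicit.
Unset Printing Implicit Defensive.

Import Order.TTheory GRing.Theory Num.Theory.
Import numFieldNormedType.Exports.

Local Open Scope classical_set_scope.
Local Open Scope ring_scope.

Section Regularity.
Context {R : realType}.

(* Only used on open sets [U]; in finite dimension, continuity of all the
   directional derivatives is continuity of the Jacobian. *)
Definition C1_on {V W : normedModType R} (U : set V) (f : V -> W) : Prop :=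
  forall x, U x ->
    differentiable f x /\ forall v, {for x, continuous (fun z => 'D_v f z)}.

Definition C2_on {V W : normedModType R} (U : set V) (f : V -> W) : Prop :=
  C1_on U f /\ forall v, C1_on U (fun z => 'D_v f z).

(* Points are row vectors and the library's ['J f x] acts on the right
   ([u *m 'J f x = 'd f x u]); the textbook Jacobian, with entry (i, j) equal
   to the j-th partial derivative of the i-th component, is its transpose. *)
Definition Jac {n m : nat} (f : 'rV[R]_n -> 'rV[R]_m) (x : 'rV[R]_n) :
  'M[R]_(m, n) := ('J f x)^T.

Definition divergence {n : nat} (f : 'rV[R]_n -> 'rV[R]_n) (x : 'rV[R]_n) : R :=
  \sum_(i < n) 'D_(delta_mx 0 i) (fun z => f z 0 i) x.

End Regularity.

Section Surfaces.
Context {R : realType} {n : nat}.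
Implicit Types (S B : set 'rV[R]_n) (x y u v w : 'rV[R]_n).

Definition dot u v : R := (u *m v^T) 0 0.

Definition slice_chart (k : nat) S (U V : set 'rV[R]_n)
    (phi psi : 'rV[R]_n -> 'rV[R]_n) : Prop :=
  [/\ open U /\ open V,
      (forall x, U x -> V (phi x) /\ psi (phi x) = x),
      (forall x, V x -> U (psi x) /\ phi (psi x) = x),
      C2_on U phi /\ C2_on V psi &
      forall x, U x ->
        (S x <-> forall i : 'I_n, (k <= i)%N -> phi x 0 i = 0)].

Definition C2_submanifold (k : nat) S : Prop :=
  (k <= n)%N /\
  forall y, S y -> exists U V phi psi, U y /\ slice_chart k S U V phi psi.

Definition tangent S y : set 'rV[R]_n :=
  [set v | exists (e : R) (c : R -> 'rV[R]_n),
    [/\ 0 < e, C1_on (ball (0 : R) e) c, (forall t, ball (0 : R) e t -> S (c t)),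
        c 0 = y & c^`()%classic 0 = v]].

Definition normal S y : set 'rV[R]_n :=
  [set w | forall v, tangent S y v -> dot w v = 0].

(* [u *m P^T] is the transpose of the column vector P u^T. *)
Definition orth_projector (T : set 'rV[R]_n) (P : 'M[R]_n) : Prop :=
  (forall u, T (u *m P^T)) /\
  (forall u v, T v -> dot (u - u *m P^T) v = 0).

(* On a C^2 submanifold the tangent space is a linear subspace, so the
   orthogonal projector exists and is unique; 0 is a default off S. *)
Definition tangent_projector S y : 'M[R]_n :=
  xget 0 (orth_projector (tangent S y)).

Definition C1_extension_near {m : nat} S (f : 'rV[R]_n -> 'rV[R]_m) y
    (O : set 'rV[R]_n) (fE : 'rV[R]_n -> 'rV[R]_m) : Prop :=
  [/\ open O, O y, C1_on O fE & forall x, S x -> O x -> fE x = f x].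

(* Maps on S are total functions of which only the values on S matter. *)
Definition C1_surface_map {m : nat} S (f : 'rV[R]_n -> 'rV[R]_m) : Prop :=
  forall y, S y -> exists O fE, C1_extension_near S f y O fE.

(* Since S is only C^2, C^1 is the regularity a normal frame can have in
   general. *)
Definition orientable (k : nat) S : Prop :=
  (k < n)%N ->
  exists N : 'I_(n - k) -> 'rV[R]_n -> 'rV[R]_n,
    [/\ forall i, C1_surface_map S (N i),
        forall i y, S y -> dot (N i y) (N i y) = 1 &
        forall y, S y -> normal S y =
          [set w | exists a : 'I_(n - k) -> R, w = \sum_i a i *: N i y]].

Definition normal_bundle S : set ('rV[R]_n * 'rV[R]_n) :=
  [set p | S p.1 /\ normal S p.1 p.2].

(* B is the C^1-diffeomorphic image, under (x, w) |-> x + w, of a relatively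
   open neighborhood of the zero section of the normal bundle; F is the
   inverse diffeomorphism. *)
Definition tubular_neighborhood S B : Prop :=
  [/\ open B, S `<=` B &
    exists (O : set ('rV[R]_n * 'rV[R]_n)) (F : 'rV[R]_n -> 'rV[R]_n * 'rV[R]_n),
    [/\ open O,
        forall x, S x -> O (x, 0),
        B = [set p.1 + p.2 | p in normal_bundle S `&` O],
        forall p, normal_bundle S p -> O p -> F (p.1 + p.2) = p &
        C1_on B F]].

Definition surface_with_band (k : nat) S B : Prop :=
  [/\ C2_submanifold k S, orientable k S & tubular_neighborhood S B].

Definition closest_point_function S B (cp : 'rV[R]_n -> 'rV[R]_n) : Prop :=
  [/\ forall x, B x -> S (cp x),
      C1_on B cp,
      forall y, S y -> cp y = y &
      forall y, S y -> Jac cp y = tangent_projector S y].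

(* The trace does not depend on the chosen extension: if u *m P^T is the
   velocity at y of a curve c in S, then the derivative of [gE] along it is the
   derivative of g o c. *)
Definition surface_div S (g : 'rV[R]_n -> 'rV[R]_n) y : R :=
  xget 0 [set d | exists O gE, C1_extension_near S g y O gE /\
                    d = \tr (Jac gE y *m tangent_projector S y)].

End Surfaces.

(* Main.v *)
Require Import Defs.
From HB Require Import structures.
From mathcomp Require Import all_boot all_order all_algebra.
From mathcomp Require Import all_classical all_reals all_analysis.

Import Order.TTheory GRing.Theory Num.Theory.
Import numFieldNormedType.Exports.
Local Open Scope classical_set_scope.
Local Open Scope ring_scope.

(** Let [gE] be a [C^1] extension of [g] near [y]. Since [cp] takes its values
    in [S] and is continuous with [cp y = y], the maps [g \o cp] and [gE \o cp]
    agree near [y]. By the chain rule the Jacobian of [g \o cp] at [y] is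
    therefore [Jac gE y *m Jac cp y], and [Jac cp y] is the tangent projector,
    so the divergence of [g \o cp] is the trace defining the surface divergence.
    This holds for every extension, which also makes that trace independent of
    the extension. *)

(** The first-order expansion of [f] at [x] carries over to [g]: the germs agree, and so do the
    values at [x] itself, as every neighborhood contains [x]. *)
Lemma near_eq_is_diff {R : numFieldType} {V W : normedModType R}
    {f g : V -> W} {x : V} :
  {near x, f =1 g} -> differentiable f x -> is_diff x g ('d f x).
Proof.
move=> fg df; have dfc := diff_continuous df.
have gE : g \o shift x = cst (g x) + 'd f x +o_ 0 id.
  have /eqaddoP fo := diff_locally df.
  apply/eqaddoP => e e0; have := fo e e0; apply: filter_app.
  have : {near 0, f \o shift x =1 g \o shift x}.
    move: fg; rewrite {1}(near_shift 0 x) subr0.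
    by apply: filter_app; apply: nearW.
  apply: filter_app; apply: nearW => h fgh.
  rewrite -[((g \o _) - _) h]/((g \o shift x) h - (g x + 'd f x h)).
  rewrite -[((f \o _) - _) h]/((f \o shift x) h - (f x + 'd f x h)).
  by rewrite -fgh (nbhs_singleton fg).
(* Uniqueness needs only the expansion and continuity of ['d f x], so ['d g x] is identified before
   [g] is known to be differentiable. *)
have dgE := diff_unique dfc gE.
by apply: DiffDef => //; apply/diff_locallyP; rewrite dgE.
Qed.

Lemma divergence_trace (R : realType) (n : nat) (f : 'rV[R]_n -> 'rV[R]_n) x :
  differentiable f x -> divergence f x = \tr (Jac f x).
Proof.
move=> df; apply: eq_bigr => i _.
have dfi : derivable f x (delta_mx 0 i) by exact: diff_derivable.
(* This passes from the derivative of the whole map, given by row [i] of ['J f x], to the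
   derivatives of its components. *)
have := derive_mx dfi.
rewrite deriveEjacobian // => /matrixP /(_ 0 i).
by rewrite -rowE !mxE.
Qed.

Lemma Jac_comp (R : realType) (n m p : nat) (f : 'rV[R]_n -> 'rV[R]_m)
    (g : 'rV[R]_m -> 'rV[R]_p) x :
  differentiable f x -> differentiable g (f x) ->
  Jac (g \o f) x = Jac g (f x) *m Jac f x.
Proof.
(* Without the transposes the factors come in reverse order; rows are compared by evaluating on
   basis vectors. *)
move=> df dg; rewrite /Jac -trmx_mul; congr (_^T).
apply/row_matrixP => i; rewrite row_mul !rowE !mul_rV_lin1.
by rewrite diff_comp.
Qed.

Lemma near_eq_Jac {R : realType} {n m : nat}
    {f g : 'rV[R]_n -> 'rV[R]_m} {x : 'rV[R]_n} :
  {near x, f =1 g} -> differentiable f x -> Jac f x = Jac g x.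
Proof.
move=> fg df; have [_ dgE] := near_eq_is_diff fg df.
exact: (congr1 (fun h => (lin1_mx h)^T) (esym dgE)).
Qed.

Lemma near_eq_comp_extension {R : realType} {n m : nat}
    {S B O : set 'rV[R]_n} {cp : 'rV[R]_n -> 'rV[R]_n}
    {g gE : 'rV[R]_n -> 'rV[R]_m} {y : 'rV[R]_n} :
  open B -> B y -> (forall x, B x -> S (cp x)) -> {for y, continuous cp} ->
  cp y = y -> C1_extension_near S g y O gE ->
  {near y, gE \o cp =1 g \o cp}.
Proof.
move=> Bo By cpS cpc cpy [Oo Oy _ gEg].
have nO : \forall x \near y, O (cp x).
  by apply: cpc; rewrite cpy; exact: open_nbhs_nbhs.
have nB : \forall x \near y, B x by exact: open_nbhs_nbhs.
by near=> x; apply: gEg; [apply: cpS|]; near: x.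
Unshelve. all: by end_near. Qed.

Theorem mainTheorem4 (R : realType) (n k : nat) (S B : set 'rV[R]_n)
  (cp : 'rV[R]_n -> 'rV[R]_n)
  (hS : surface_with_band k S B)
  (hcp : closest_point_function S B cp)
  (g : 'rV[R]_n -> 'rV[R]_n) (hg : C1_surface_map S g)
  (y : 'rV[R]_n) (hy : S y) :
  differentiable (g \o cp) y /\
  divergence (g \o cp) y = surface_div S g y.
Proof.
have [_ _ [Bo SB _]] := hS; have [cpS cpC1 cpid cpJ] := hcp.
have By := SB _ hy; have [dcp _] := cpC1 _ By; have cpy := cpid _ hy.
have key D gE : C1_extension_near S g y D gE -> differentiable (g \o cp) y /\
    divergence (g \o cp) y = \tr (Jac gE y *m tangent_projector S y).
  move=> ext; have [_ Dy gEC1 _] := ext; have [dgE _] := gEC1 _ Dy.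
  have dgE' : differentiable gE (cp y) by rewrite cpy.
  have dgEcp := differentiable_comp dcp dgE'.
  have eqn := near_eq_comp_extension Bo By cpS
    (differentiable_continuous dcp) cpy ext.
  have [dgcp _] := near_eq_is_diff eqn dgEcp.
  split=> //; rewrite divergence_trace // -(near_eq_Jac eqn) //.
  by rewrite Jac_comp // cpy cpJ.
have [D [gE ext]] := hg _ hy; have [dgcp _] := key _ _ ext; split=> //.
(* The extension [gE'] picked by [xget] may differ from [gE], but [key] covers both; the existence
   of [gE] rules out the default value 0. *)
rewrite /surface_div; case: xgetP => [d _ [D' [gE' [ext' ->]]]|none].
  by have [_ ->] := key _ _ ext'.
by case: (none (\tr (Jac gE y *m tangent_projector S y))); exists D, gE.
Qed.
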